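(* Let $X$ be a finite cell complex with $\operatorname{rk}\widetilde H_{i+1}(X)=0$, $\operatorname{rk}\widetilde H_i(X)=1$ and $\operatorname{rk}\widetilde H_{i-1}(X)=0$. Then there is a bijection, via the complement operator, between the set $\mathcal U^i$ of $i$-dimensional dual cycletrees of $X$ and the set $\mathcal T_i$ of $i$-dimensional spanning trees of $X$ (spanning trees of zero weight included). Moreover, for $T\in\mathcal T_i$ and $U^*=\overline T\in\mathcal U^i$, $$|c(C_{U^*})|=\mathrm{wt}(U^* )\,|c(\widehat{C_{U^*}})|=\mathrm{wt}(T)\,|\widetilde H^{i+1}(X)|.$$ Also, $c(C_{U^*})=0$ if and only if $\mathrm{wt}(T)=0$.
   Context: Notation: $X$ has dimension $d$ and $0\le i\le d$; $X_j$ is the finite set of $j$-cells of $X$ (in a fixed order), $C_j=C_j(X)$ is the free abelian group on $X_j$ for $0\le j\le d$, $C_{-1}=\mathbb Z$, other $C_j=0$; $\partial_j:C_j\to C_{j-1}$ is the integer cellular boundary matrix, with $\partial_0(x)=1$ for each vertex $x$ (augmented complex); $\delta_j=\partial_{j+1}^t:C_j\to C_{j+1}$. $Z_j=\ker\partial_j$, $B_j=\operatorname{im}\partial_{j+1}$, $Z^j=\ker\delta_j$, $B^j=\operatorname{im}\delta_{j-1}$ (over $\mathbb Z$), $\widetilde H_j=Z_j/B_j$, $\widetilde H^j=Z^j/B^j$; $H^j(X,A)$ is relative cellular cohomology with integer coefficients. $\mathcal S_i$ is the set of subcomplexes $Y$ with $X^{i-1}\subseteq Y\subseteq X^i$ ($X^j$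 the $j$-skeleton); $Y$ is determined by its set $I(Y)\subseteq X_i$ of $i$-cells. The complement $\overline Y\in\mathcal S_i$ has $I(\overline Y)=X_i\setminus I(Y)$. For a basis $Z$ of a free abelian group, $[\cdot]_Z$ denotes coordinates (column by column) in that basis. $\mathcal T_i$: elements $T\in\mathcal S_i$ with $|I(T)|=\operatorname{rk}Z_{i-1}(X)$; $\mathrm{wt}(T)=|\widetilde H_{i-1}(T)|$ if finite, and $\mathrm{wt}(T)=0$ otherwise (a ''spanning tree with zero weight''). $\mathcal U^i$: an $i$-dimensional dual cycletree is $U^*\in\mathcal S_i$ with $|I(U^* )|=\operatorname{rk}Z^{i+1}(X)+1$; $\mathrm{wt}(U^* )=|H^{i+1}(X,\overline{U^*})|$ if finite, and $0$ otherwise. Its cocycle part $C_{U^*}\in Z^i(X)$: let $A$ be the $m\times(m+1)$ submatrix of $[\delta_i]_Z$ ($Z$ a basis of $Z^{i+1}(X)$, $m=\operatorname{rk}Z^{i+1}(X)$) with columns indexed by $I(U^* )$; the $j$-th entry of $C_{U^*}$ along $I(U^* )$ is $(-1)^j\det([A]_j)$, where $[A]_j$ is $A$ with its $j$-th column deleted; other entries are $0$. $\widehat{C_{U^*}}=C_{U^*}/\gcd(C_{U^*})$, where $\gcd(C_{U^*})$ is the gcd of the entries ($\widehat{C_{U^*}}=0$ if $C_{U^*}=0$). Cutting number: let $\overline\delta_{i-1}$ be a reduced matrix of $\delta_{i-1}$, i.e. a matrix with $\operatorname{rk}\delta_{i-1}$ columns and $\operatorname{im}\overline\delta_{i-1}=\operatorname{im}\delta_{i-1}$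 as vector spaces, obtained for example by choosing its columns to be a basis for the column space of $\delta_{i-1}$. For a fixed basis $Z'$ of $Z^i(X)$, the cutting number $c:Z^i(X)\to\mathbb Z$ is $c(z)=\det([z]_{Z'},[\overline\delta_{i-1}]_{Z'})$.
   Formalization: The equality with wt(T)|H^{i+1}(X)| is stated only for reduced matrices whose columns generate im δ_{i-1} over Z, not merely as a vector space: doubling a column doubles c (two points, i=0, (2,2)^t gives 2, not 1). The other claims hold for every reduced matrix. *)

(* Defs.v *)
From HB Require Import structures.
From mathcomp Require Import all_boot all_order all_algebra.
From mathcomp Require Import finmap.
From mathcomp Require Import mathcomp_extra boolp classical_sets functions cardinality.

Set Implicit Arguments.
Unset Strict Implicit.
Unset Printing Implicit Defensive.

Import GRing.Theory.

Local Open Scope ring_scope.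

(** * Subquotients of Z^n *)

Definition zindep_mod n (L : set 'cV[int]_n) r (v : 'M[int]_(n, r)) : Prop :=
  forall a : 'cV[int]_r, L (v *m a) -> a = 0.

(** Rank of the abelian group M / L, for L <= M subgroups of Z^n: the largest
    number of elements of M that are Z-linearly independent modulo L.  Such a
    family is independent in Z^n, so bounding the search by n loses nothing. *)
Definition quot_rank n (M L : set 'cV[int]_n) : nat :=
  \max_(r < n.+1 |
     `[< exists v : 'M[int]_(n, r),
           (forall j, M (col j v)) /\ zindep_mod L v >]) r.

Definition free_rank n (M : set 'cV[int]_n) : nat :=
  quot_rank M (fun x => x = 0).

Definition cosets n (M L : set 'cV[int]_n) : set (set 'cV[int]_n) :=
  fun K => exists2 x, M x & K = (fun y => exists2 l, L l & y = x + l).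

(** |M / L| if this is finite, and 0 otherwise. *)
Definition quot_order n (M L : set 'cV[int]_n) : nat :=
  if `[< finite_set (cosets M L) >] then #|` fset_set (cosets M L) | else 0%N.

(** The columns of Z form a basis of the free abelian group M. *)
Definition is_basis n m (M : set 'cV[int]_n) (Z : 'M[int]_(n, m)) : Prop :=
  (forall x, M x <-> exists y : 'cV[int]_m, x = Z *m y)
  /\ (forall y : 'cV[int]_m, Z *m y = 0 -> y = 0).

(** Coordinates, column by column, of V in the basis Z: the (unique) Y with
    Z Y = V; only meaningful when the columns of V lie in the span of Z. *)
Definition coords n m p (Z : 'M[int]_(n, m)) (V : 'M[int]_(n, p)) :
    'M[int]_(m, p) :=
  xget 0 (fun Y : 'M[int]_(m, p) => Z *m Y = V).

Definition rat_mx p q (M : 'M[int]_(p, q)) : 'M[rat]_(p, q) :=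
  map_mx intr M.

(** * Finite cell complexes *)

(** A finite cell complex enters through its cells and its cellular boundary
    matrices: the cells of dimension j are numbered by 'I_(ncells j), and
    [bd j] is the boundary from C_(j+1) to C_j. *)
Record cell_complex := CellComplex {
  cdim : nat;
  ncells : nat -> nat;
  ncells0 : (0 < ncells 0)%N;
  ncells_dim : (0 < ncells cdim)%N;
  ncells_gt : forall j, (cdim < j)%N -> ncells j = 0%N;
  bd : forall j, 'M[int]_(ncells j, ncells j.+1);
  bd_aug : (const_mx 1 : 'rV[int]_(ncells 0)) *m bd 0 = 0;
  bd_bd : forall j, bd j *m bd j.+1 = 0
}.

(** Level k of the augmented complex is degree k - 1: [chain X k] is C_(k-1),
    with level 0 the augmentation C_(-1) = Z.  All indices k below are levels;
    indices i and j are dimensions, that is, level i.+1 and j.+1. *)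
Definition crank (X : cell_complex) (k : nat) : nat :=
  if k is j.+1 then ncells X j else 1.

Definition chain (X : cell_complex) (k : nat) : Type := 'cV[int]_(crank X k).

(** [bdry X j] is the boundary of degree j, from C_j to C_(j-1), and
    [cobdry X j] is the coboundary of degree j - 1, from C_(j-1) to C_j. *)
Definition bdry (X : cell_complex) (j : nat) :
    'M[int]_(crank X j, crank X j.+1) :=
  match j with
  | 0 => const_mx 1
  | j'.+1 => bd X j'
  end.

Definition cobdry (X : cell_complex) (j : nat) :
    'M[int]_(crank X j.+1, crank X j) := (bdry X j)^T.

(** Subcomplexes, as families of sets of cells. *)
Definition cell_family (X : cell_complex) : Type :=
  forall k, {set 'I_(crank X k)}.

Definition all_cells (X : cell_complex) : cell_family X := fun k => [set: _]%SET.

Definition no_cells (X : cell_complex) : cell_family X := fun k => finset.set0.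

(** The subcomplex Y with X^(i-1) <= Y <= X^i and I(Y) = I.  At level i.+1 the
    ordinals x and y have convertible types only once k is known to be i.+1;
    comparing their values avoids a cast. *)
Definition spanned (X : cell_complex) (i : nat) (I : {set 'I_(ncells X i)}) :
    cell_family X :=
  fun k => [set x : 'I_(crank X k) |
    (k < i.+1)%N || ((k == i.+1) && [exists y in I, y == x :> nat])]%SET.

Section Homology.
Variables (X : cell_complex) (Y : cell_family X).

Definition supported k (c : chain X k) : Prop :=
  forall x, x \notin Y k -> c x 0 = 0.

Definition vanishing k (c : chain X k) : Prop :=
  forall x, x \in Y k -> c x 0 = 0.

(** Z_(k-1)(Y) and B_(k-1)(Y). *)
Definition cycles k : set (chain X k) :=
  fun c => supported c /\
    match k return chain X k -> Prop with
    | 0 => fun _ => True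
    | j.+1 => fun c => bdry X j *m c = 0
    end c.

Definition boundaries k : set (chain X k) :=
  fun c => exists2 b : chain X k.+1, supported b & c = bdry X k *m b.

(** Z^(k-1)(X, Y) and B^(k-1)(X, Y), for cochains that vanish on Y. *)
Definition rel_cocycles k : set (chain X k) :=
  fun c => vanishing c /\ cobdry X k *m c = 0.

Definition rel_coboundaries k : set (chain X k) :=
  match k return set (chain X k) with
  | 0 => fun c => c = 0
  | j.+1 => fun c => exists2 b : chain X j, vanishing b & c = cobdry X j *m b
  end.

(** The order of the reduced homology group of Y in degree k - 1, and of the
    relative cohomology group of (X, Y) in degree k - 1; 0 when infinite. *)
Definition homology_order k : nat := quot_order (@cycles k) (@boundaries k).

Definition rel_cohomology_order k : nat :=
  quot_order (@rel_cocycles k) (@rel_coboundaries k).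

End Homology.

(** Z_(k-1)(X), Z^(k-1)(X), B^(k-1)(X), and the rank of reduced homology and
    the order of reduced cohomology of X in degree k - 1. *)
Definition Zcyc (X : cell_complex) k : set (chain X k) :=
  @cycles X (all_cells X) k.

Definition Zcoc (X : cell_complex) k : set (chain X k) :=
  @rel_cocycles X (no_cells X) k.

Definition Bcob (X : cell_complex) k : set (chain X k) :=
  @rel_coboundaries X (no_cells X) k.

Definition homology_rank (X : cell_complex) k : nat :=
  quot_rank (@Zcyc X k) (@boundaries X (all_cells X) k).

Definition cohomology_order (X : cell_complex) k : nat :=
  quot_order (@Zcoc X k) (@Bcob X k).

(** * Spanning trees and dual cycletrees *)

Section Trees.
Variables (X : cell_complex) (i : nat).

(** A subcomplex between X^(i-1) and X^i is given by its set of i-cells. *)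
Definition spanning_trees : {set {set 'I_(ncells X i)}} :=
  [set T : {set 'I_(ncells X i)} | #|T| == free_rank (@Zcyc X i)].

Definition wt_tree (T : {set 'I_(ncells X i)}) : nat :=
  homology_order (spanned T) i.

(** The rank of Z^(i+1)(X). *)
Definition cocycle_rank : nat := free_rank (@Zcoc X i.+2).

Definition dual_cycletrees : {set {set 'I_(ncells X i)}} :=
  [set U : {set 'I_(ncells X i)} | #|U| == cocycle_rank.+1].

Definition wt_dual (U : {set 'I_(ncells X i)}) : nat :=
  rel_cohomology_order (spanned (~: U)) i.+2.

(** The entry of the cocycle part at x in U is (-1)^j det [A]_j, where x is the
    j-th element of U.  Counting from 1 as usual for matrices, the sign at the
    0-based position j is (-1)^(j+1).  The default value of [nth] is never used
    when #|U| is cocycle_rank.+1. *)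
Definition cocycle_part (Z : 'M[int]_(crank X i.+2, cocycle_rank))
    (U : {set 'I_(ncells X i)}) : chain X i.+1 :=
  \col_(x < ncells X i)
    if x \in U then
      let D : 'M[int]_(cocycle_rank, ncells X i) := coords Z (cobdry X i.+1) in
      let A := \matrix_(r < cocycle_rank, l < cocycle_rank.+1)
                 D r (nth x (enum U) l) in
      let j : 'I_cocycle_rank.+1 := inord (index x (enum U)) in
      (-1) ^+ j.+1 * \det (col' j A)
    else 0.

End Trees.

Definition gcd_entries n (v : 'cV[int]_n) : nat :=
  \big[gcdn/0%N]_(x < n) `|v x 0%R|%N.

(** v / gcd(v); this is 0 when v = 0. *)
Definition primitive_part n (v : 'cV[int]_n) : 'cV[int]_n :=
  \col_x (v x 0%R %/ (gcd_entries v)%:Z)%Z.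

(** * Cutting number *)

(** The rank of the coboundary of degree i - 1. *)
Definition cobdry_rank (X : cell_complex) (i : nat) : nat :=
  \rank (rat_mx (cobdry X i)).

(** The matrix [db] has the same column space as the coboundary, over Q. *)
Definition reduced_cobdry (X : cell_complex) (i : nat)
    (db : 'M[int]_(crank X i.+1, cobdry_rank X i)) : Prop :=
  ((rat_mx db)^T == (rat_mx (cobdry X i))^T)%MS.

(** The matrix [db] has the same image as the coboundary, over Z.  This is
    stronger than [reduced_cobdry]: doubling a column of [db] preserves the
    latter and doubles the cutting number. *)
Definition integral_cobdry (X : cell_complex) (i : nat)
    (db : 'M[int]_(crank X i.+1, cobdry_rank X i)) : Prop :=
  forall x : chain X i.+1,
    @Bcob X i.+1 x <-> exists y : 'cV[int]_(cobdry_rank X i), x = db *m y.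

(** Z' is a basis of Z^i(X); the matrix is square when the reduced homology of
    degree i has rank 1, for then Z^i(X) has rank one more than the coboundary. *)
Definition cutting_number (X : cell_complex) (i : nat)
    (Z' : 'M[int]_(crank X i.+1, (cobdry_rank X i).+1))
    (db : 'M[int]_(crank X i.+1, cobdry_rank X i)) (z : chain X i.+1) : int :=
  \det (row_mx (coords Z' z) (coords Z' db)
         : 'M[int]_((cobdry_rank X i).+1, 1 + cobdry_rank X i)).

(* Main.v *)
Require Import Defs.
From HB Require Import structures.
From mathcomp Require Import all_boot all_order all_algebra.
From mathcomp Require Import finmap.
From mathcomp Require Import mathcomp_extra boolp classical_sets functions cardinality.

Set Implicit Arguments.
Unset Strict Implicit.
Unset Printing Implicit Defensive.

Import Order.TTheory GRing.Theory Num.Theory.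

Local Open Scope ring_scope.

(** Write r for the rank of the coboundary into C_i and m for the rank of
    Z^(i+1)(X).  The three conditions on homology say that the ranks of the
    boundary maps around degree i are r and m, that rk Z_(i-1)(X) = r, and that
    X has (m + 1) + r cells of dimension i (free_rank_Zcyc, cocycle_rankE,
    ncellsE); hence the complement exchanges the sets of r cells with the sets
    of m + 1 cells, which is the bijection.

    All the orders are determinants, because the index of the lattice generated
    by the columns of a square matrix is the absolute value of its determinant,
    with 0 standing for an infinite index (quot_order_det).  By the Smith normal
    form, an integer matrix with m rows and at least m columns
    is a product K W with K square and W the first rows of a unimodular matrix
    (smith_completion), so that its cokernel has order |det K|.  Express the
    coboundary out of C_i in a basis of Z^(i+1)(X) as a matrix E = K W; then
    |H^(i+1)(X)| = |det K|, which is not zero since E has rank m.  The columns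
    of E at the cells of U form a matrix A = K_A W_A, so wt(U) = |det K_A|; this
    is also the gcd of the maximal minors of A, that is, of the entries of C_U
    (gcd_signed_minors).  The first equality is then linearity of c.

    The heart of the proof is a comparison of complementary minors.  Let N be
    the basis of Z^i(X), d the reduced coboundary, z a cocycle that vanishes on
    T, w a row vector, and V a right inverse of W.  Stack E, w and the
    restriction to T into a square matrix G.  Expanding along w identifies det G
    with w . C_U up to sign (absdet_complete).  On the other hand (V N) is
    unimodular, so the matrix (V z d) has determinant c(z) up to sign, while its
    product with G is block triangular with diagonal blocks K, w . z and the
    restriction d_T.  Therefore (absdet_triangular)

      |w . C_U| |c(z)| = |det K| |w . z| |det d_T|.

    If C_U is not 0, the choice z = C_U gives |c(C_U)| = |det K| |det d_T|.  If
    C_U = 0, the formula for any nonzero z forces det d_T = 0, and the equality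
    still holds; such a z exists because Z^i(X) has rank r + 1 and T only r
    cells (det_signed_minors).

    Finally the boundary of degree i is P F with P a basis of Z_(i-1)(X), so
    wt(T) is the absolute value of the determinant of the T-columns of F
    (wt_tree_det).  The columns of the transpose of F generate B^i(X).  If the
    columns of d do so too, the two matrices have the same r x r minors up to
    sign; if d only spans the same rational space, corresponding minors are
    still zero together.  This turns det d_T into wt(T). *)

(** * Absolute determinants across propositionally equal sizes *)

(** The absolute value of the determinant of a matrix whose two dimensions are
    equal but written differently, such as r + (1 + m) and a number of cells;
    for a matrix that is not square the value carries no information. *)
Definition absdet p q (M : 'M[int]_(p, q)) : nat :=
  `|\det (conform_mx (0 : 'M_p) M)|%N.

Lemma absdet_sq p (M : 'M[int]_p) : absdet M = `|\det M|%N.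
Proof. by rewrite /absdet conform_mx_id. Qed.

Lemma absdet_mul p q s (M : 'M[int]_(p, q)) (N : 'M[int]_(q, s)) :
  p = q -> q = s -> absdet (M *m N) = (absdet M * absdet N)%N.
Proof.
by move=> epq eqs; subst p s; rewrite !absdet_sq det_mulmx abszM.
Qed.

Lemma absdet_inv p q (M : 'M[int]_(p, q)) (N : 'M[int]_(q, p)) :
  p = q -> M *m N = 1%:M -> absdet M = 1%N /\ absdet N = 1%N.
Proof.
move=> epq /(congr1 (@absdet p p)).
rewrite absdet_mul // [RHS]absdet_sq det1 => /eqP.
by rewrite muln_eq1 => /andP[/eqP -> /eqP ->].
Qed.

Lemma absdet_castmx p q p' q' (e : (p = p') * (q = q')) (M : 'M[int]_(p, q)) :
  absdet (castmx e M) = absdet M.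
Proof. by case: e => e1 e2; subst p' q'; rewrite castmx_id. Qed.

Lemma absdet_col_mxC p q n (M : 'M[int]_(p, n)) (N : 'M[int]_(q, n)) :
  (p + q)%N = n -> absdet (col_mx M N) = absdet (col_mx N M).
Proof.
move=> epq.
pose P : 'M[int]_(p + q, q + p) := block_mx 0 1%:M 1%:M 0.
have -> : col_mx M N = P *m col_mx N M.
  by rewrite mul_block_col !mul1mx !mul0mx add0r addr0.
rewrite absdet_mul ?[(q + p)%N]addnC //.
have [|//|-> _] := @absdet_inv _ _ P (block_mx 0 1%:M 1%:M 0); last by rewrite mul1n.
  by rewrite addnC.
by rewrite mulmx_block !mul1mx !mul0mx !add0r !addr0 -scalar_mx_block.
Qed.

Lemma absdet_ublock p q s (M : 'M[int]_(p, q)) (N : 'M[int]_(p, s)) :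
  p = q -> absdet (block_mx M N 0 1%:M) = absdet M.
Proof. by move=> epq; subst q; rewrite !absdet_sq det_ublock det1 mulr1. Qed.

(** * Smith normal form *)

(** Column operations turn a wide matrix into a square one followed by zero
    columns; undoing them exhibits E as K times the first rows of a unimodular
    matrix. *)
Lemma smith_completion m p n (E : 'M[int]_(m, n)) : n = (m + p)%N ->
  exists (K : 'M[int]_m) (W : 'M[int]_(m, n)) (W' : 'M[int]_(p, n))
         (V : 'M[int]_(n, m)) (V' : 'M[int]_(n, p)),
    [/\ E = K *m W, W *m V = 1%:M, W *m V' = 0
      & col_mx W W' *m row_mx V V' = 1%:M].
Proof.
move=> en; subst n.
have [L uL [R uR [d _ ->]]] := int_Smith_normal_form E.
exists (L *m \matrix_(i, j) (d`_i *+ (i == j :> nat))).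
exists (usubmx R), (dsubmx R), (lsubmx (invmx R)), (rsubmx (invmx R)).
have RV : block_mx (usubmx R *m lsubmx (invmx R)) (usubmx R *m rsubmx (invmx R))
    (dsubmx R *m lsubmx (invmx R)) (dsubmx R *m rsubmx (invmx R)) = 1%:M.
  by rewrite -mul_col_row hsubmxK vsubmxK mulmxV.
have := RV; rewrite (@scalar_mx_block _ m p) => /eq_block_mx[-> -> _ _].
split=> //; last by rewrite mul_col_row RV scalar_mx_block.
rewrite -!mulmxA; congr (_ *m _).
rewrite -{1}(vsubmxK R).
set D := (X in X *m col_mx _ _).
have -> : D = row_mx (\matrix_(i, j) (d`_i *+ (i == j :> nat))) 0.
  apply/matrixP=> i j; rewrite !mxE; case: splitP => k ->; rewrite !mxE //.
  by rewrite ltn_eqF // ltn_addr.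
by rewrite mul_row_col mul0mx addr0.
Qed.

(** * Orders of cokernels *)

Lemma is_basis_mul n m (M : set 'cV[int]_n) (Z : 'M[int]_(n, m)) (L : 'M[int]_m) :
  L \in unitmx -> is_basis M Z -> is_basis M (Z *m L).
Proof.
move=> uL [ZM Zinj]; split=> [x|y].
  rewrite ZM; split=> [[y ->]|[y ->]].
    by exists (invmx L *m y); rewrite -mulmxA mulKVmx.
  by exists (L *m y); rewrite mulmxA.
rewrite -mulmxA => /Zinj /(congr1 (mulmx (invmx L))).
by rewrite mulKmx // mulmx0.
Qed.

Lemma absz_det_unit m (L : 'M[int]_m) : L \in unitmx -> `|\det L|%N = 1%N.
Proof. by move=> uL; rewrite -absdet_sq; have [] := absdet_inv erefl (mulmxV uL). Qed.

Section DiagonalQuotient.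
Variables (n m : nat) (M L : set 'cV[int]_n) (Z : 'M[int]_(n, m)).
Variable d : 'I_m -> int.
Hypothesis basisZ : is_basis M Z.
Hypothesis imL :
  forall x, L x <-> exists2 t : 'cV[int]_m, x = Z *m t & forall i, (d i %| t i ord0)%Z.

Let coset (t : 'cV[int]_m) : set 'cV[int]_n :=
  fun y => exists2 l, L l & y = Z *m t + l.

Let Zinj (s t : 'cV[int]_m) : Z *m s = Z *m t -> s = t.
Proof.
move=> e; apply/eqP; rewrite -subr_eq0; apply/eqP; apply: basisZ.2.
by rewrite mulmxBr e subrr.
Qed.

Let cosets_mem t : cosets M L (coset t).
Proof. by exists (Z *m t) => //; apply/basisZ.1; exists t. Qed.

Let coset_eq (s t : 'cV[int]_m) :
  (forall i, (d i %| s i ord0 - t i ord0)%Z) -> coset s = coset t.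
Proof.
have sub (u v : 'cV[int]_m) : (forall i, (d i %| u i ord0 - v i ord0)%Z) ->
    (coset u `<=` coset v)%classic.
  move=> duv _ [l /imL[w -> dw] ->]; exists (Z *m (u - v + w)).
    by apply/imL; exists (u - v + w) => // i; rewrite mxE rpredD ?dw // !mxE; apply: duv.
  by rewrite -!mulmxDr addrA addrCA subrr addr0.
move=> dst; apply/seteqP; split; apply: sub => // i.
by rewrite -opprB rpredN.
Qed.

Let coset_dvd (s t : 'cV[int]_m) i : coset s = coset t -> (d i %| s i ord0 - t i ord0)%Z.
Proof.
move=> e; have: coset s (Z *m s).
  exists 0; last by rewrite addr0.
  by apply/imL; exists 0 => [|j]; rewrite ?mulmx0 // mxE dvdz0.
rewrite e => -[_ /imL[w -> dw]]; rewrite -mulmxDr => /Zinj ->.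
by rewrite mxE addrAC subrr add0r.
Qed.

(** Cosets are told apart by the residues of their coordinates; where
    d i = 0, one coordinate is free and the quotient is infinite, and then both
    sides are 0, the left one by convention. *)
Lemma quot_order_diag : quot_order M L = absz (\prod_i d i).
Proof.
have [/existsP[i0 /eqP d0]|dn0] := boolP [exists i, d i == 0].
  rewrite (bigD1 i0) //= d0 mul0r /quot_order.
  case: asboolP => // fin; exfalso.
  pose g (k : nat) := coset (k%:Z *: delta_mx i0 0).
  have gT : [set: nat]%classic = (g @^-1` cosets M L)%classic.
    by apply/seteqP; split=> k // _; apply: cosets_mem.
  apply: infinite_nat; rewrite gT.
  apply: finite_preimage fin => k l _ _ /(@coset_dvd _ _ i0).
  by rewrite d0 dvd0z !mxE !eqxx !mulr1 subr_eq0 => /eqP[].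
have {}dn0 i : d i != 0 by move: dn0; rewrite negb_exists => /forallP.
pose S : Type := {dffun forall i : 'I_m, 'I_(absz (d i))}.
pose g (s : S) := coset (\col_i (s i : nat)%:Z).
have ginj : injective g.
  move=> s t est; apply/ffunP=> i; apply/val_inj => /=.
  have := coset_dvd i est; rewrite !mxE -eqz_mod_dvd.
  by rewrite -!(modz_abs _ (d i)) !modz_nat !modn_small // => /eqP[].
have gsurj K : cosets M L K -> exists s, K = g s.
  move=> [x /basisZ.1[y ->] ->].
  have bound i : (`|(y i ord0 %% d i)%Z|%N < `|d i|)%N.
    by rewrite -ltz_nat !abszE ger0_norm ?modz_ge0 ?ltz_mod.
  pose s : S := [ffun i => Ordinal (bound i)].
  exists s; apply: coset_eq => i.
  rewrite !mxE ffunE /= abszE ger0_norm ?modz_ge0 //.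
  by rewrite -eqz_mod_dvd modz_mod.
have eqC : cosets M L = [set` [fset g s | s in [set: S]%SET]%fset]%classic.
  apply/seteqP; split=> K /=.
    by move=> /gsurj[s ->]; apply/imfsetP; exists s; rewrite ?inE.
  by move=> /imfsetP[s _ ->]; apply: cosets_mem.
rewrite /quot_order asboolT; last by rewrite eqC; apply: finite_fset.
rewrite eqC set_fsetK card_imfset //= -cardE.
rewrite cardsT card_dep_ffun foldrE big_map big_enum /=.
rewrite (@big_morph _ _ absz 1%N muln 1 *%R abszM) //.
by apply: eq_bigr => k _; rewrite card_ord.
Qed.
End DiagonalQuotient.

(** The Smith normal form U D V of K reduces to a diagonal matrix: U changes the
    basis of M, and V the generators of L, by unimodular matrices. *)
Lemma quot_order_det n m (M L : set 'cV[int]_n) (Z : 'M[int]_(n, m))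
    (K : 'M[int]_m) :
  is_basis M Z -> (forall x, L x <-> exists y : 'cV[int]_m, x = Z *m K *m y) ->
  quot_order M L = `|\det K|%N.
Proof.
have [U uU [V uV [d _ ->]]] := int_Smith_normal_form K.
set D := (X in U *m X *m V) => bZ imL.
have diagD (t : 'cV[int]_m) i : (D *m t) i ord0 = d`_i * t i ord0.
  rewrite mxE (bigD1 i) //= !mxE eqxx big1 ?addr0 // => j ji.
  by rewrite !mxE val_eqE eq_sym (negbTE ji) mul0r.
have -> : D = diag_mx (\row_i d`_i).
  by apply/matrixP=> i j; rewrite !mxE val_eqE.
rewrite !det_mulmx !abszM (absz_det_unit uU) (absz_det_unit uV) mul1n muln1 det_diag.
under eq_bigr do rewrite mxE.
apply: quot_order_diag (is_basis_mul uU bZ) _ => x; rewrite imL.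
split=> [[y ->]|[t -> dt]].
  exists (D *m (V *m y)); first by rewrite !mulmxA.
  by move=> i; rewrite diagD dvdz_mulr.
exists (invmx V *m (\col_i (t i ord0 %/ d`_i)%Z)).
rewrite !mulmxA (mulmxK uV) -!mulmxA; do 2!congr (_ *m _).
apply/colP=> i; rewrite diagD mxE mulrC.
by have := dt i; rewrite dvdz_eq => /eqP ->.
Qed.

(** * Integral and rational ranks *)

Lemma rat_mx_inj p q : injective (@rat_mx p q).
Proof.
move=> M N /matrixP e; apply/matrixP=> i j.
by have := e i j; rewrite !mxE => /intr_inj.
Qed.

Lemma rat_mxM p q s (M : 'M[int]_(p, q)) (N : 'M[int]_(q, s)) :
  rat_mx (M *m N) = rat_mx M *m rat_mx N.
Proof. exact: map_mxM. Qed.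

Lemma rat_mx0 p q : rat_mx (0 : 'M[int]_(p, q)) = 0.
Proof. exact: map_mx0. Qed.

Lemma rat_mx1 p : rat_mx (1%:M : 'M[int]_p) = 1%:M.
Proof. exact: map_mx1. Qed.

Lemma rat_mx_tr p q (M : 'M[int]_(p, q)) : rat_mx M^T = (rat_mx M)^T.
Proof. by rewrite /rat_mx map_trmx. Qed.

Lemma clear_denominators p q (M : 'M[rat]_(p, q)) :
  exists2 d : int, d != 0 & exists N : 'M[int]_(p, q), rat_mx N = d%:~R *: M.
Proof.
exists (\prod_(k : 'I_p * 'I_q) denq (M k.1 k.2)).
  by apply/prodf_neq0 => k _; apply: denq_neq0.
exists (\matrix_(i, j)
  (numq (M i j) * \prod_(k : 'I_p * 'I_q | k != (i, j)) denq (M k.1 k.2))).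
apply/matrixP=> i j; rewrite !mxE [in RHS](bigD1 (i, j)) //= !intrM.
rewrite mulrAC; congr (_ * _).
by rewrite -{3}[M i j]divq_num_den mulrCA mulfV ?mulr1 ?intr_eq0 ?denq_neq0.
Qed.

(** A rational relation between v and A becomes an integral one after clearing
    denominators, so independence over Z modulo a lattice persists over Q. *)
Lemma zindep_mod_rat n r q (v : 'M[int]_(n, r)) (A : 'M[int]_(n, q)) :
  zindep_mod (fun x => exists y : 'cV[int]_q, x = A *m y) v ->
  forall p (u : 'M[rat]_(p, r)) (s : 'M[rat]_(p, q)),
    u *m (rat_mx v)^T = s *m (rat_mx A)^T -> u = 0.
Proof.
move=> ind p u s e; apply/row_matrixP=> i; rewrite row0.
have {}e : row i u *m (rat_mx v)^T = row i s *m (rat_mx A)^T.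
  by rewrite -!row_mul e.
have [d d0 [N eN]] := clear_denominators (row_mx (row i u) (row i s)).
have eL : rat_mx (lsubmx N) = d%:~R *: row i u.
  by rewrite /rat_mx map_lsubmx [map_mx _ _]eN scale_row_mx row_mxKl.
have eR : rat_mx (rsubmx N) = d%:~R *: row i s.
  by rewrite /rat_mx map_rsubmx [map_mx _ _]eN scale_row_mx row_mxKr.
have lN0 : (lsubmx N)^T = 0.
  apply: ind; exists (rsubmx N)^T; apply: rat_mx_inj; apply: trmx_inj.
  by rewrite !rat_mxM !rat_mx_tr !trmx_mul !trmxK eL eR -!scalemxAl e.
have: d%:~R *: row i u = 0.
  by rewrite -eL -[lsubmx N]trmxK lN0 trmx0 rat_mx0.
by move/eqP; rewrite scaler_eq0 intr_eq0 (negbTE d0) => /eqP.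
Qed.

Lemma quot_rank_eq n (M L : set 'cV[int]_n) k :
  (exists v : 'M[int]_(n, k), (forall j, M (col j v)) /\ zindep_mod L v) ->
  (forall r (v : 'M[int]_(n, r)),
     (forall j, M (col j v)) -> zindep_mod L v -> (r <= k)%N) ->
  (k <= n)%N -> quot_rank M L = k.
Proof.
move=> exk maxk lekn; apply/eqP; rewrite eqn_leq; apply/andP; split.
  apply/bigmax_leqP => r /asboolP[v [Mv iv]]; exact: maxk Mv iv.
have lekn1 : (k < n.+1)%N by [].
rewrite -[X in (X <= _)%N]/(nat_of_ord (Ordinal lekn1)).
by apply: leq_bigmax_cond; apply/asboolP.
Qed.

(** Over Q, the span of A has a complement C inside the kernel of B.  A basis of
    C with its denominators cleared is an independent family of maximal size. *)
Lemma quot_rank_homology p n q (B : 'M[int]_(p, n)) (A : 'M[int]_(n, q))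
    (M L : set 'cV[int]_n) :
  (forall x, M x <-> B *m x = 0) ->
  (forall x, L x <-> exists y : 'cV[int]_q, x = A *m y) ->
  B *m A = 0 ->
  (quot_rank M L + \rank (rat_mx B) + \rank (rat_mx A))%N = n.
Proof.
move=> MB LA BA0.
have eL : L = (fun x => exists y : 'cV[int]_q, x = A *m y).
  by apply/funext => x; apply/propext.
have eM r (v : 'M[int]_(n, r)) : (forall j, M (col j v)) <-> B *m v = 0.
  split=> [Mv|Bv j]; last by apply/MB; rewrite colE mulmxA Bv mul0mx.
  apply/matrixP=> i j; have /MB/matrixP/(_ i ord0) := Mv j.
  by rewrite colE mulmxA -colE !mxE.
pose KB := kermx (rat_mx B)^T.
have rKB : \rank KB = (n - \rank (rat_mx B))%N by rewrite mxrank_ker mxrank_tr.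
have leB : (\rank (rat_mx B) <= n)%N by apply: rank_leq_col.
have AKB : ((rat_mx A)^T <= KB)%MS.
  by apply/sub_kermxP; rewrite -trmx_mul -rat_mxM BA0 rat_mx0 trmx0.
have leA := mxrankS AKB; rewrite mxrank_tr rKB in leA.
pose C := (KB :\: (rat_mx A)^T)%MS.
have rC : (\rank C = n - \rank (rat_mx B) - \rank (rat_mx A))%N.
  have := mxrank_cap_compl KB (rat_mx A)^T.
  rewrite rKB (capmx_idPr AKB) mxrank_tr -/C => <-; by rewrite addKn.
suff -> : quot_rank M L = \rank C by rewrite rC addnAC subnK // subnK.
rewrite eL; apply: quot_rank_eq; last by apply: rank_leq_col.
- have [d d0 [N eN]] := clear_denominators (row_base C).
  have Nfree p' (u : 'M_(p', _)) : u *m rat_mx N = 0 -> u = 0.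
    rewrite eN -scalemxAr => /eqP; rewrite scaler_eq0 intr_eq0 (negbTE d0) /=.
    by rewrite mulmx_free_eq0 ?row_base_free // => /eqP.
  have NC : (rat_mx N <= C)%MS by rewrite eN scalemx_sub // eq_row_base.
  exists N^T; split.
    apply/eM; apply: trmx_inj; rewrite trmx_mul trmxK trmx0; apply: rat_mx_inj.
    rewrite rat_mxM rat_mx_tr rat_mx0; apply/sub_kermxP.
    exact: submx_trans NC (diffmxSl _ _).
  move=> a [y e]; apply: trmx_inj; rewrite trmx0; apply: rat_mx_inj; rewrite rat_mx0.
  apply: Nfree; apply/eqP; rewrite -submx0 -(capmx_diff KB (rat_mx A)^T).
  rewrite sub_capmx (submx_trans (submxMl _ _) NC) /=.
  rewrite -rat_mxM -[a^T *m N]trmxK trmx_mul trmxK e trmx_mul rat_mxM.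
  by rewrite !rat_mx_tr; apply: submxMl.
- move=> r v /eM Bv /zindep_mod_rat ind.
  pose v' := (rat_mx v)^T.
  have vfree : row_free v'.
    rewrite -kermx_eq0; apply/eqP/(ind _ _ 0).
    by rewrite mul0mx; apply/sub_kermxP.
  have cap0 : (v' :&: (rat_mx A)^T = 0)%MS.
    apply/eqP; rewrite -submx0.
    have [/submxP[u eu] /submxP[s es]] : (v' :&: (rat_mx A)^T <= v')%MS
        /\ (v' :&: (rat_mx A)^T <= (rat_mx A)^T)%MS.
      by split; [apply: capmxSl | apply: capmxSr].
    by rewrite eu (ind _ u s) ?mul0mx ?submx_refl // -eu -es.
  have vKB : (v' <= KB)%MS.
    by apply/sub_kermxP; rewrite -trmx_mul -rat_mxM Bv rat_mx0 trmx0.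
  have: (v' + (rat_mx A)^T <= KB)%MS by rewrite addsmx_sub vKB AKB.
  move/mxrankS; rewrite mxrank_disjoint_sum // (eqP vfree) mxrank_tr rKB rC.
  by move=> le_r; rewrite leq_subRL // addnC.
Qed.

(** An integral kernel is saturated, hence a direct summand: it has a basis P
    with an integral left inverse Q.  Let the rows of N be integral vectors that
    span the kernel over Q, and N = K W its Smith factorization with W V = 1;
    then P and Q are the transposes of W and V.  An
    integral vector of the rational span of W is x = u W, and its coordinates
    u = x V are integral. *)
Lemma kernel_basis p q s (B : 'M[int]_(p, q)) :
  (s + \rank (rat_mx B))%N = q ->
  exists (P : 'M[int]_(q, s)) (Q : 'M[int]_(s, q)),
    [/\ B *m P = 0, Q *m P = 1%:M & forall x : 'cV_q, B *m x = 0 -> P *m (Q *m x) = x].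
Proof.
move=> es.
pose KB := kermx (rat_mx B)^T.
have rKB : \rank KB = s.
  apply/eqP; rewrite mxrank_ker mxrank_tr -(eqn_add2r (\rank (rat_mx B))).
  by rewrite subnK ?rank_leq_col // es.
have [d d0 [N eN]] := clear_denominators (row_base KB).
have freeN := row_base_free KB; have eqN := eq_row_base KB.
move: N eN freeN eqN; move: (row_base KB); rewrite rKB => KB' N eN freeN eqN.
have [K [W [W' [V [V' [eNK WV _ _]]]]]] := smith_completion N (esym es).
have NKB : (rat_mx N :=: KB)%MS.
  by rewrite eN; apply: eqmx_trans (eqmx_scale _ _) eqN; rewrite intr_eq0.
have rN : \rank (rat_mx N) = s by rewrite NKB.
have uK : rat_mx K \in unitmx.
  rewrite -row_full_unit /row_full eqn_leq rank_leq_col /= -{1}rN eNK rat_mxM.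
  exact: mxrankM_maxl.
exists W^T, V^T; split; first 2 last.
- move=> x Bx; apply: trmx_inj; rewrite !trmx_mul !trmxK.
  apply: rat_mx_inj.
  have: ((rat_mx x)^T <= rat_mx N)%MS.
    by rewrite NKB; apply/sub_kermxP; rewrite -trmx_mul -rat_mxM Bx rat_mx0 trmx0.
  case/submxP => u; rewrite -rat_mx_tr => ex.
  have {}ex : rat_mx x^T = u *m rat_mx K *m rat_mx W by rewrite ex eNK rat_mxM mulmxA.
  by rewrite !rat_mxM ex -(mulmxA _ (rat_mx W)) -rat_mxM WV rat_mx1 mulmx1.
- apply: trmx_inj; apply: rat_mx_inj.
  have: rat_mx N *m (rat_mx B)^T = 0 by apply/sub_kermxP; rewrite NKB.
  rewrite eNK rat_mxM -mulmxA => /(congr1 (mulmx (invmx (rat_mx K)))).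
  by rewrite mulKmx // mulmx0 trmx_mul trmxK rat_mxM rat_mx_tr trmx0 rat_mx0.
- by rewrite -trmx_mul WV trmx1.
Qed.

(** * Signed maximal minors *)

Lemma dvdz_mulmx p q s (d : int) (M : 'M[int]_(p, q)) (N : 'M[int]_(q, s)) :
  (forall i j, (d %| N i j)%Z) -> forall i j, (d %| (M *m N) i j)%Z.
Proof.
by move=> dN i j; rewrite mxE; apply: rpred_sum => k _; apply: dvdz_mull.
Qed.

Lemma dvdn_gcd_entries n (v : 'cV[int]_n) (d : nat) :
  (d %| gcd_entries v)%N = [forall x, (d%:Z %| v x ord0)%Z].
Proof.
rewrite /gcd_entries (@big_morph _ _ (dvdn d) true andb 0%N gcdn) ?dvdn0 //.
  by rewrite big_andE.
by move=> a b; rewrite dvdn_gcd.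
Qed.

Lemma primitive_partK n (v : 'cV[int]_n) :
  (gcd_entries v)%:Z *: primitive_part v = v.
Proof.
apply/colP=> x; rewrite !mxE mulrC; apply/eqP; rewrite -dvdz_eq.
by have := dvdnn (gcd_entries v); rewrite dvdn_gcd_entries => /forallP.
Qed.

(** The generalized cross product of the rows of A, up to sign. *)
Definition signed_minors m (A : 'M[int]_(m, m.+1)) : 'cV[int]_(1 + m) :=
  \col_l ((-1) ^+ l.+1 * \det (col' l A)).

Lemma mul_signed_minors m (A : 'M[int]_(m, m.+1)) (w : 'rV[int]_(1 + m)) :
  (w *m signed_minors A) ord0 ord0 = - \det (col_mx w A : 'M_(1 + m)).
Proof.
rewrite (expand_det_row _ (lshift m ord0)) mxE -sumrN; apply: eq_bigr => l _.
rewrite col_mxEu.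
rewrite [signed_minors A l _]mxE exprS mulN1r mulNr mulrN; congr (- (_ * _)).
rewrite /cofactor add0n; congr (_ * \det _); apply/matrixP=> i j; apply: esym.
rewrite !mxE; case: splitP => k /=; rewrite /bump /= add1n.
  by move=> ek; move: (ltn_ord k); rewrite -ek.
by case=> /val_inj ->.
Qed.

(** Pairing with a row of A gives a determinant with a repeated row. *)
Lemma signed_minors_kernel m (A : 'M[int]_(m, m.+1)) : A *m signed_minors A = 0.
Proof.
apply/colP=> i; rewrite mxE.
have := mul_signed_minors A (row i A); rewrite -row_mul !mxE => ->.
rewrite (determinant_alternate (i1 := lshift m ord0) (i2 := rshift 1 i)) ?oppr0 // => j.
by rewrite col_mxEu col_mxEd mxE.
Qed.

(** The maximal minors of [K W] are those of [W] multiplied by [det K], and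
    since [W] extends to a unimodular matrix its own minors are coprime. *)
Lemma gcd_signed_minors m n (A : 'M[int]_(m, m.+1)) (K : 'M[int]_m)
    (W : 'M[int]_(m, m.+1)) (W' : 'rV[int]_(1 + m)) (J : 'M[int]_(n, 1 + m))
    (J' : 'M[int]_(1 + m, n)) :
  A = K *m W -> absdet (col_mx W W') = 1%N -> J' *m J = 1%:M ->
  gcd_entries (J *m signed_minors A) = `|\det K|%N.
Proof.
move=> eA uW J'J; apply/eqP; rewrite eqn_dvd; apply/andP; split.
  have detW' : `|(W' *m signed_minors A) ord0 ord0|%N = `|\det K|%N.
    rewrite mul_signed_minors abszN eA.
    have -> : col_mx W' (K *m W) = block_mx 1%:M 0 0 K *m col_mx W' W.
      by rewrite mul_block_col !mul0mx mul1mx addr0 add0r.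
    rewrite det_mulmx (det_ublock 1%:M 0 K) det1 mul1r abszM -(absdet_sq (col_mx W' W)).
    by rewrite absdet_col_mxC // uW muln1.
  rewrite -detW' -[(_ %| _)%N]/(((gcd_entries _)%:Z %| _)%Z).
  rewrite -[W']mulmx1 -J'J mulmxA -mulmxA.
  apply: dvdz_mulmx => i j; rewrite [j]ord1.
  have := dvdnn (gcd_entries (J *m signed_minors A)).
  by rewrite dvdn_gcd_entries => /forallP.
rewrite dvdn_gcd_entries; apply/forallP => x.
rewrite -[(_ %| _)%Z]/(\det K %| (J *m signed_minors A) x ord0)%Z.
apply: dvdz_mulmx => l j; rewrite mxE eA.
have -> : col' l (K *m W) = K *m col' l W.
  by apply/matrixP=> a b; rewrite !mxE; apply: eq_bigr => c _; rewrite !mxE.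
by rewrite det_mulmx dvdz_mull // dvdz_mulr.
Qed.

(** * Complementary minors *)

Section ComplementaryMinors.
Variables (n m r : nat) (JU : 'M[int]_(1 + m, n)) (JT : 'M[int]_(r, n)).
Hypothesis en : n = ((1 + m) + r)%N.
Hypothesis JJ : col_mx JU JT *m (col_mx JU JT)^T = 1%:M.

Let en' : n = (m + (1 + r))%N.
Proof. by rewrite en add1n addSnnS. Qed.

(** In the coordinates that list the first selected cells and then the others,
    the restriction to the latter is (0 1), which leaves the determinant of E
    and w on the former. *)
Lemma absdet_complete (E : 'M[int]_(m, n)) (w : 'rV[int]_n) :
  absdet (col_mx E (col_mx w JT)) =
    `|(w *m JU^T *m signed_minors (E *m JU^T)) ord0 ord0|%N.
Proof.
have := JJ; rewrite tr_col_mx mul_col_row (@scalar_mx_block _ (1 + m) r).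
move=> /eq_block_mx[_ _ TU TT].
have [_ uJ] := absdet_inv (esym en) JJ.
rewrite mul_signed_minors abszN -absdet_sq [RHS]absdet_col_mxC //.
rewrite -[RHS](@absdet_ublock _ _ _ _ (col_mx (E *m JT^T) (w *m JT^T))) ?addn1 //.
rewrite col_mxA absdet_castmx.
have <- : absdet (col_mx (col_mx E w) JT *m (col_mx JU JT)^T) =
    absdet (col_mx (col_mx E w) JT).
  by rewrite absdet_mul ?uJ ?muln1 // en addn1.
by rewrite tr_col_mx mul_col_row TU TT !mul_col_mx.
Qed.

(** The product of (E; w; JT) and (V, N y, N W) is block triangular, and the
    second factor is the unimodular matrix (V N) times diag(1, (y W)). *)
Lemma absdet_triangular (E : 'M[int]_(m, n)) (K : 'M[int]_m) (V : 'M[int]_(n, m))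
    (N : 'M[int]_(n, 1 + r)) (w : 'rV[int]_n) (y : 'cV[int]_(1 + r))
    (W : 'M[int]_(1 + r, r)) :
  E *m V = K -> E *m N = 0 -> absdet (row_mx V N) = 1%N -> JT *m (N *m y) = 0 ->
  (absdet (col_mx E (col_mx w JT)) * `|\det (row_mx y W : 'M_(1 + r))|)%N =
  (`|\det K| * `|(w *m (N *m y)) ord0 ord0| * `|\det (JT *m (N *m W))|)%N.
Proof.
move=> EV EN uVN Ty.
have eX : row_mx V (row_mx (N *m y) (N *m W)) =
    row_mx V N *m (block_mx 1%:M 0 0 (row_mx y W : 'M_(1 + r)) : 'M_(m + (1 + r))).
  by rewrite mul_row_block !mulmx0 mulmx1 addr0 add0r mul_mx_row.
have eG : col_mx E (col_mx w JT) *m row_mx V (row_mx (N *m y) (N *m W)) =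
    block_mx K 0 (col_mx w JT *m V)
      (block_mx (w *m (N *m y)) (w *m (N *m W)) 0 (JT *m (N *m W))).
  have EN0 k (Y : 'M_(_, k)) : E *m (N *m Y) = 0 by rewrite mulmxA EN mul0mx.
  by rewrite mul_col_row mul_mx_row EV !EN0 row_mx0 mul_col_row Ty.
have := congr1 (@absdet _ _) eG.
rewrite absdet_mul // eX absdet_mul // uVN mul1n !absdet_sq.
rewrite (det_lblock 1%:M) det1 mul1r => ->.
rewrite det_lblock (@det_ublock _ 1 r) !abszM -mulnA; congr (_ * (_ * _))%N.
by rewrite det_mx11.
Qed.

End ComplementaryMinors.

(** V and V' together are unimodular, and (V V') is (V N) times diag(1, Y). *)
Lemma unimodular_completion m p n (W : 'M[int]_(m, n)) (W' : 'M[int]_(p, n))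
    (V : 'M[int]_(n, m)) (V' : 'M[int]_(n, p)) (N : 'M[int]_(n, p)) :
  n = (m + p)%N -> col_mx W W' *m row_mx V V' = 1%:M ->
  (exists Y, V' = N *m Y) -> absdet (row_mx V N) = 1%N.
Proof.
move=> en uWV [Y eV'].
have eX : row_mx V V' = row_mx V N *m (block_mx 1%:M 0 0 Y : 'M_(m + p)).
  by rewrite mul_row_block !mulmx0 mulmx1 addr0 add0r eV'.
have: absdet (row_mx V V') = 1%N.
  by have [] := absdet_inv (esym en) uWV.
by rewrite eX absdet_mul // => /eqP; rewrite muln_eq1 => /andP[/eqP].
Qed.

Lemma mulmx1_swap p q (M : 'M[int]_(p, q)) (N : 'M[int]_(q, p)) :
  p = q -> M *m N = 1%:M -> N *m M = 1%:M.
Proof. by move=> e; subst q; apply: mulmx1C. Qed.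

Lemma col_neq0_witness n (v : 'cV[int]_n) :
  v != 0 -> exists w : 'rV[int]_n, (w *m v) ord0 ord0 != 0.
Proof.
move=> v0; have /existsP[x vx] : [exists x, v x ord0 != 0].
  apply: contraR v0; rewrite negb_exists => /forallP v0.
  by apply/eqP/colP => x; rewrite mxE; apply/eqP; rewrite -[_ == _]negbK v0.
by exists (delta_mx ord0 x); rewrite -rowE mxE.
Qed.

Lemma det_row_mxZ r (c : int) (z : 'cV[int]_(1 + r)) (W : 'M[int]_(1 + r, r)) :
  \det (row_mx (c *: z) W : 'M_(1 + r)) = c * \det (row_mx z W : 'M_(1 + r)).
Proof.
have -> : row_mx (c *: z) W = row_mx z W *m block_mx (c%:M : 'M_1) 0 0 1%:M.
  by rewrite mul_row_block !mulmx0 mulmx1 addr0 add0r mul_mx_scalar.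
by rewrite det_mulmx det_ublock det1 det_scalar mulr1 mulrC.
Qed.

Lemma det_row_mx0 r (W : 'M[int]_(1 + r, r)) :
  \det (row_mx (0 : 'cV_(1 + r)) W : 'M_(1 + r)) = 0.
Proof. by rewrite -(scale0r (0 : 'cV_(1 + r))) det_row_mxZ mul0r. Qed.

(** The formula of [absdet_triangular] holds for every row w and every z with N z
    vanishing on the cells of JT.  For z = y, a row w with w . N y <> 0 cancels.
    If y = 0, the formula for a nonzero kernel vector z of JT N, which has one
    column more than rows, makes JT N W singular. *)
Lemma det_signed_minors n m r (JU : 'M[int]_(1 + m, n)) (JT : 'M[int]_(r, n))
    (E : 'M[int]_(m, n)) (K : 'M[int]_m) (V : 'M[int]_(n, m))
    (N : 'M[int]_(n, 1 + r)) (y : 'cV[int]_(1 + r)) (W : 'M[int]_(1 + r, r)) :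
  n = ((1 + m) + r)%N -> col_mx JU JT *m (col_mx JU JT)^T = 1%:M ->
  E *m V = K -> E *m N = 0 -> absdet (row_mx V N) = 1%N -> \det K != 0 ->
  (forall z : 'cV_(1 + r), N *m z = 0 -> z = 0) ->
  N *m y = JU^T *m signed_minors (E *m JU^T) ->
  `|\det (row_mx y W : 'M_(1 + r))|%N = (`|\det K| * `|\det (JT *m (N *m W))|)%N.
Proof.
move=> en JJ EV EN uVN K0 Ninj Ny.
have := JJ; rewrite tr_col_mx mul_col_row (@scalar_mx_block _ (1 + m) r).
move=> /eq_block_mx[_ _ TU _].
have key (w : 'rV[int]_n) (z : 'cV[int]_(1 + r)) : JT *m (N *m z) = 0 ->
    (`|(w *m (N *m y)) ord0 ord0| * `|\det (row_mx z W : 'M_(1 + r))|)%N =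
    (`|\det K| * `|(w *m (N *m z)) ord0 ord0| * `|\det (JT *m (N *m W))|)%N.
  move=> Tz; rewrite -(absdet_triangular en w W EV EN uVN Tz).
  by rewrite (absdet_complete en JJ) Ny mulmxA.
have [Ny0|/col_neq0_witness[w wNy]] := eqVneq (N *m y) 0; last first.
  have Ty : JT *m (N *m y) = 0 by rewrite Ny mulmxA TU mul0mx.
  apply/eqP; have := key w y Ty; rewrite -mulnA mulnCA => /eqP.
  by rewrite eqn_pmul2l // lt0n absz_eq0.
(* All the signed minors vanish, so JT N W has to be singular. *)
have -> : y = 0 by apply: Ninj.
rewrite det_row_mx0 absz0; apply/esym/eqP.
have [K2 [W2 [W2' [V2 [z [eTN _ W2z /eqP uz]]]]]] :=
  @smith_completion r 1 _ (JT *m N) (addnC 1%N r).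
have Tz : JT *m (N *m z) = 0 by rewrite mulmxA eTN -mulmxA W2z mulmx0.
have z0 : z != 0.
  apply: contraTneq uz => ->; apply/eqP.
  move/(congr1 (fun M : 'M_(r + 1) => drsubmx M)).
  rewrite mul_col_row block_mxKdr mulmx0 (@scalar_mx_block _ r 1) block_mxKdr.
  by move/matrixP/(_ ord0 ord0); rewrite !mxE.
have /col_neq0_witness[w wNz] : N *m z != 0.
  by apply: contra z0 => /eqP/Ninj ->.
have := key w z Tz; rewrite Ny0 mulmx0 mxE absz0 mul0n => /esym/eqP.
by rewrite !muln_eq0 !absz_eq0 (negbTE K0) (negbTE wNz).
Qed.

(** * Selecting cells *)

Section Selection.
Variables (n k : nat) (S : {set 'I_n}) (cardS : #|S| = k).

Definition nth_cell (l : 'I_k) : 'I_n := enum_val (cast_ord (esym cardS) l).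

(** Restriction of chains to [S]; its transpose is extension by zero. *)
Definition sel : 'M[int]_(k, n) := rowsub nth_cell 1%:M.

Lemma nth_cell_in l : nth_cell l \in S. Proof. exact: enum_valP. Qed.

Lemma nth_cell_inj : injective nth_cell.
Proof. by move=> a b /enum_val_inj /cast_ord_inj. Qed.

Lemma nth_cellP x : x \in S -> exists l, x = nth_cell l.
Proof.
move=> xS; exists (cast_ord cardS (enum_rank_in xS x)).
by rewrite /nth_cell cast_ordK enum_rankK_in.
Qed.

Lemma mul_sel p (M : 'M[int]_(n, p)) l j : (sel *m M) l j = M (nth_cell l) j.
Proof. by rewrite /sel -rowsubE mxE. Qed.

Lemma mul_sel_tr p (M : 'M[int]_(p, n)) i l : (M *m sel^T) i l = M i (nth_cell l).
Proof. by rewrite -[M in LHS]trmxK -trmx_mul mxE mul_sel mxE. Qed.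

Lemma sel_trE p (M : 'M[int]_(k, p)) l j : (sel^T *m M) (nth_cell l) j = M l j.
Proof.
rewrite mxE (bigD1 l) //= !mxE eqxx mul1r big1 ?addr0 // => l' ll'.
by rewrite !mxE (inj_eq nth_cell_inj) (negbTE ll') mul0r.
Qed.

Lemma sel_tr_out p (M : 'M[int]_(k, p)) x j : x \notin S -> (sel^T *m M) x j = 0.
Proof.
move=> xS; rewrite mxE big1 // => l _; rewrite !mxE.
by case: eqP => [e|_]; rewrite ?mul0r //; rewrite -e nth_cell_in in xS.
Qed.

End Selection.

Section ComplementarySelection.
Variables (n k l : nat) (S T : {set 'I_n}).
Variables (cardS : #|S| = k) (cardT : #|T| = l).
Hypothesis ST : S = ~: T.

Lemma sel_orthonormal :
  col_mx (sel cardS) (sel cardT) *m (col_mx (sel cardS) (sel cardT))^T = 1%:M.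
Proof.
have selsel a (A : {set 'I_n}) (cA : #|A| = a) : sel cA *m (sel cA)^T = 1%:M.
  apply/matrixP=> i j; rewrite mul_sel !mxE eq_sym (inj_eq (nth_cell_inj (cardS := cA))).
  by rewrite eq_sym.
rewrite tr_col_mx mul_col_row !selsel (@scalar_mx_block _ k l); congr block_mx.
  apply/matrixP=> i j; rewrite mul_sel !mxE; case: eqP => // e.
  by have := nth_cell_in cardS i; rewrite -e ST inE nth_cell_in.
apply/matrixP=> i j; rewrite mul_sel !mxE; case: eqP => // e.
by have := nth_cell_in cardS j; rewrite e ST inE nth_cell_in.
Qed.

Lemma sel_size : n = (k + l)%N.
Proof. by rewrite -cardS -cardT ST addnC cardsC card_ord. Qed.

(** The projections onto the cells of S and of T sum to the identity, and the
    second one kills b. *)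
Lemma sel_tr_selK (b : 'cV[int]_n) :
  (forall x, x \in T -> b x ord0 = 0) -> (sel cardS)^T *m (sel cardS *m b) = b.
Proof.
move=> b0; have := mulmx1_swap (esym sel_size) sel_orthonormal.
rewrite tr_col_mx mul_row_col => e.
rewrite -[RHS]mul1mx -e mulmxDl -!mulmxA [X in _ + _ *m X](_ : _ = 0).
  by rewrite mulmx0 addr0.
by apply/colP=> a; rewrite mul_sel b0 ?nth_cell_in // mxE.
Qed.

End ComplementarySelection.

(** * Coordinates in a basis *)

Lemma is_basis_iff n m (M M' : set 'cV[int]_n) (Z : 'M[int]_(n, m)) :
  (forall x, M x <-> M' x) -> is_basis M Z -> is_basis M' Z.
Proof. by move=> MM' [ZM Zi]; split=> // x; rewrite -MM'. Qed.

Lemma lift_columns n m p (Z : 'M[int]_(n, m)) (V : 'M[int]_(n, p)) :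
  (forall j, exists y : 'cV[int]_m, col j V = Z *m y) ->
  exists Y : 'M[int]_(m, p), Z *m Y = V.
Proof.
move=> /fin_all_exists[f ef].
exists (\matrix_(i, j) f j i ord0); apply/matrixP=> i j.
have /colP/(_ i) := ef j; rewrite !mxE => ->.
by apply: eq_bigr => k _; rewrite mxE.
Qed.

Lemma coordsK n m p (M : set 'cV[int]_n) (Z : 'M[int]_(n, m)) (V : 'M[int]_(n, p)) :
  is_basis M Z -> (forall j, M (col j V)) -> Z *m coords Z V = V.
Proof.
move=> [ZM _] MV; rewrite /coords.
apply: (@xgetPex _ 0 (fun Y : 'M[int]_(m, p) => Z *m Y = V)).
by apply: lift_columns => j; apply/ZM.
Qed.

Lemma is_basis_inj n m p (M : set 'cV[int]_n) (Z : 'M[int]_(n, m))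
    (A B : 'M[int]_(m, p)) : is_basis M Z -> Z *m A = Z *m B -> A = B.
Proof.
move=> [_ Zi] e; apply/eqP; rewrite -subr_eq0; apply/eqP/matrixP=> i j.
have : col j (A - B) = 0 by apply: Zi; rewrite colE mulmxA mulmxBr e subrr mul0mx.
by move/colP/(_ i); rewrite !mxE.
Qed.

(** * The chain complex of a cell complex *)

Lemma bdry_bdry X j : bdry X j *m bdry X j.+1 = 0.
Proof. by case: j => [|j]; [apply: bd_aug | apply: bd_bd]. Qed.

Lemma cobdry_cobdry X j : cobdry X j.+1 *m cobdry X j = 0.
Proof. by rewrite /cobdry -trmx_mul bdry_bdry trmx0. Qed.

(** The map whose kernel is Z_(k-1)(X) at every level, level 0 included. *)
Definition bdry_out (X : cell_complex) (k : nat) :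
    'M[int]_(if k is j.+1 then crank X j else 0, crank X k) :=
  match k with 0 => 0 | j.+1 => bdry X j end.

Lemma bdry_out_bdry X k : bdry_out X k *m bdry X k = 0.
Proof. by case: k => [|k]; [apply: mul0mx | apply: bdry_bdry]. Qed.

Lemma cyclesP X (Y : cell_family X) k (x : chain X k) :
  cycles Y x <-> supported Y x /\ bdry_out X k *m x = 0.
Proof.
rewrite /cycles; case: k x => [|k] x //=; split=> -[sx _]; split=> //.
exact: mul0mx.
Qed.

Lemma ZcycP X k (x : chain X k) : Zcyc x <-> bdry_out X k *m x = 0.
Proof.
split=> [/cyclesP[]//|Bx]; apply/cyclesP; split=> // y; by rewrite inE.
Qed.

Lemma all_boundariesP X k (x : chain X k) :
  boundaries (all_cells X) x <-> exists y : chain X k.+1, x = bdry X k *m y.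
Proof.
split=> [[b _ ->]|[b ->]]; exists b => // y; by rewrite inE.
Qed.

Lemma ZcocP X k (x : chain X k) : Zcoc x <-> cobdry X k *m x = 0.
Proof. by split=> [[]|Cx] //; split=> // y; rewrite inE. Qed.

Lemma BcobP X k (x : chain X k.+1) :
  Bcob x <-> exists y : chain X k, x = cobdry X k *m y.
Proof.
split=> [[b _ ->]|[b ->]]; exists b => // y; by rewrite inE.
Qed.

Lemma homology_rankE X k :
  (homology_rank X k + \rank (rat_mx (bdry_out X k)) + \rank (rat_mx (bdry X k)))%N
    = crank X k.
Proof.
apply: quot_rank_homology (bdry_out_bdry X k) => x; first exact: ZcycP.
exact: all_boundariesP.
Qed.

Lemma free_rank_kernel p n (B : 'M[int]_(p, n)) (M : set 'cV[int]_n) :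
  (forall x, M x <-> B *m x = 0) -> (free_rank M + \rank (rat_mx B))%N = n.
Proof.
move=> MB; pose A : 'M[int]_(n, 0) := 0.
rewrite -[RHS](@quot_rank_homology _ _ _ B A M (fun x => x = 0)) ?mulmx0 //.
  by rewrite rat_mx0 mxrank0 addn0.
by move=> x; split=> [->|[y ->]]; [exists 0; rewrite mul0mx | rewrite mul0mx].
Qed.

Lemma rank_cobdry X k : \rank (rat_mx (cobdry X k)) = \rank (rat_mx (bdry X k)).
Proof. by rewrite /cobdry rat_mx_tr mxrank_tr. Qed.

Lemma spanned_below X i (I : {set 'I_(ncells X i)}) k (x : 'I_(crank X k)) :
  (k < i.+1)%N -> x \in spanned I k.
Proof. by move=> ki; rewrite inE ki. Qed.

Lemma spanned_at X i (I : {set 'I_(ncells X i)}) (x : 'I_(crank X i.+1)) :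
  (x \in spanned I i.+1) = (x \in I).
Proof.
rewrite inE ltnn eqxx /=; apply/existsP/idP => [[y /andP[yI /eqP/val_inj <-]]//|xI].
by exists x; rewrite xI eqxx.
Qed.

Lemma spanned_above X i (I : {set 'I_(ncells X i)}) (x : 'I_(crank X i.+2)) :
  x \notin spanned I i.+2.
Proof. by rewrite inE ltnNge leqnSn /= eqSS gtn_eqF. Qed.

(** Restricted to cocycles, since [coords] is a default value elsewhere. *)
Lemma cutting_numberZ X i Z' db (c : int) (z : chain X i.+1) :
  is_basis (@Zcoc X i.+1) Z' -> Zcoc z ->
  cutting_number (i := i) Z' db (c *: z) = c * cutting_number Z' db z.
Proof.
move=> bZ' Zz; rewrite /cutting_number.
have Zc (u : chain X i.+1) : Zcoc u -> Z' *m coords Z' u = u.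
  move=> Zu; apply: (coordsK bZ') => j; rewrite (_ : col j u = u) //.
  by apply/colP=> a; rewrite !mxE [j]ord1.
have -> : coords Z' (c *: z) = c *: coords Z' z.
  apply: (is_basis_inj bZ'); rewrite -scalemxAr !Zc //.
  by apply/ZcocP; rewrite -scalemxAr (ZcocP z).1 // scaler0.
exact: det_row_mxZ.
Qed.

Lemma cocycle_partE X i (Z : 'M[int]_(crank X i.+2, cocycle_rank X i))
    (U : {set 'I_(ncells X i)}) (cardU : #|U| = (cocycle_rank X i).+1) :
  cocycle_part Z U =
    (sel cardU)^T *m signed_minors (coords Z (cobdry X i.+1) *m (sel cardU)^T).
Proof.
apply/colP => x; rewrite mxE; case: ifPn => [xU|xU]; last by rewrite sel_tr_out.
have [l ->] := nth_cellP cardU xU; rewrite sel_trE mxE.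
have nthE y (l' : 'I_(cocycle_rank X i).+1) : nth y (enum U) l' = nth_cell cardU l'.
  by rewrite /nth_cell (enum_val_nth y).
have ix : index (nth_cell cardU l) (enum U) = l.
  by rewrite -(nthE (nth_cell cardU l) l) index_uniq ?enum_uniq // -cardE cardU.
rewrite ix inord_val; congr (_ * \det (col' l _)).
by apply/matrixP=> a b; rewrite mul_sel_tr mxE nthE.
Qed.

(** * Weights as determinants *)

Lemma quot_order_factor n m p (M L : set 'cV[int]_n) (Z : 'M[int]_(n, m))
    (G : 'M[int]_(m, p)) (K : 'M[int]_m) (W : 'M[int]_(m, p)) (V : 'M[int]_(p, m)) :
  is_basis M Z -> G = K *m W -> W *m V = 1%:M ->
  (forall x, L x <-> exists y : 'cV[int]_p, x = Z *m G *m y) ->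
  quot_order M L = `|\det K|%N.
Proof.
move=> bZ -> WV LG; apply: (quot_order_det bZ) => x; rewrite LG.
split=> -[y ->]; first by exists (W *m y); rewrite !mulmxA.
by exists (V *m y); rewrite -!mulmxA [W *m _]mulmxA WV mul1mx.
Qed.

(** Relative cochains vanish on T, that is, they are extended by zero from U; above
    degree i the complex T has no cells, so all cocycles are relative ones. *)
Lemma wt_dual_det X i (Z : 'M[int]_(crank X i.+2, cocycle_rank X i))
    (E : 'M[int]_(cocycle_rank X i, crank X i.+1)) k l (T U : {set 'I_(ncells X i)})
    (cardU : #|U| = k) (cardT : #|T| = l) (K : 'M[int]_(cocycle_rank X i))
    (W : 'M[int]_(cocycle_rank X i, k)) (V : 'M[int]_(k, cocycle_rank X i)) :
  is_basis (@Zcoc X i.+2) Z -> Z *m E = cobdry X i.+1 -> U = ~: T ->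
  E *m (sel cardU)^T = K *m W -> W *m V = 1%:M ->
  wt_dual U = `|\det K|%N.
Proof.
move=> bZ ZE UT eK WV; rewrite /wt_dual /rel_cohomology_order UT finset.setCK.
apply: (quot_order_factor (Z := Z) _ eK WV).
  apply: is_basis_iff bZ => x; rewrite ZcocP; split=> [Cx|[]//]; split=> // c.
  by rewrite (negbTE (spanned_above T c)).
move=> x; rewrite mulmxA ZE; split=> [[b b0 ->]|[y ->]].
  exists (sel cardU *m b); rewrite -mulmxA (sel_tr_selK cardU cardT UT) // => c cT.
  by apply: b0; rewrite spanned_at.
exists ((sel cardU)^T *m y); last by rewrite mulmxA.
by move=> c; rewrite spanned_at => cT; rewrite sel_tr_out // UT inE negbK.
Qed.

(** T contains all cells of dimension below i, hence all cycles of degree i - 1. *)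
Lemma wt_tree_det X i r (P : 'M[int]_(crank X i, r)) (F : 'M[int]_(r, crank X i.+1))
    l (T U : {set 'I_(ncells X i)}) (cardT : #|T| = r) (cardU : #|U| = l) :
  is_basis (@Zcyc X i) P -> P *m F = bdry X i -> T = ~: U ->
  wt_tree T = `|\det (F *m (sel cardT)^T)|%N.
Proof.
move=> bP PF TU; rewrite /wt_tree /homology_order.
apply: (quot_order_det (Z := P)).
  apply: is_basis_iff bP => x; rewrite ZcycP cyclesP; split=> [|[]//].
  by split=> // c; rewrite spanned_below.
move=> x; rewrite mulmxA PF; split=> [[b b0 ->]|[y ->]].
  exists (sel cardT *m b); rewrite -mulmxA (sel_tr_selK cardT cardU TU) // => c cU.
  by apply: b0; rewrite spanned_at TU inE cU.
exists ((sel cardT)^T *m y); last by rewrite mulmxA.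
by move=> c; rewrite spanned_at => cT; rewrite sel_tr_out.
Qed.

Lemma rat_mx_det m (M : 'M[int]_m) : \det (rat_mx M) = (\det M)%:~R.
Proof. exact: det_map_mx. Qed.

Lemma det_neq0_of_rank p q m (A : 'M[int]_(p, m)) (K : 'M[int]_m) (B : 'M[int]_(m, q)) :
  \rank (rat_mx (A *m K *m B)) = m -> \det K != 0.
Proof.
move=> rk; rewrite -(intr_eq0 rat) -rat_mx_det -unitfE -unitmxE.
rewrite -row_full_unit /row_full eqn_leq rank_leq_col /= -{1}rk !rat_mxM.
by rewrite (leq_trans (mxrankM_maxl _ _)) ?mxrankM_maxr.
Qed.

(** * Trees and dual cycletrees *)

Section AcyclicRanks.
Variables (X : cell_complex) (i : nat).
Hypotheses (hHsucc : homology_rank X i.+2 = 0%N) (hH : homology_rank X i.+1 = 1%N)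
  (hHpred : homology_rank X i = 0%N).

Lemma free_rank_Zcyc : free_rank (@Zcyc X i) = cobdry_rank X i.
Proof.
rewrite /cobdry_rank rank_cobdry.
have := etrans (free_rank_kernel (@ZcycP X i)) (esym (homology_rankE X i)).
by rewrite hHpred add0n [RHS]addnC => /addIn.
Qed.

Lemma cocycle_rankE : cocycle_rank X i = \rank (rat_mx (cobdry X i.+1)).
Proof.
have := etrans (free_rank_kernel (@ZcocP X i.+2)) (esym (homology_rankE X i.+2)).
by rewrite hHsucc !rank_cobdry => /addIn.
Qed.

Lemma ncellsE : ncells X i = ((cocycle_rank X i).+1 + cobdry_rank X i)%N.
Proof.
rewrite cocycle_rankE /cobdry_rank !rank_cobdry.
apply: etrans (esym (homology_rankE X i.+1)) _.
by rewrite hH -addnA add1n addSn addnC.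
Qed.

Lemma spanning_treeE (T : {set 'I_(ncells X i)}) :
  (T \in spanning_trees X i) = (~: T \in dual_cycletrees X i).
Proof.
rewrite !inE free_rank_Zcyc.
have e : (#|T| + #|~: T|)%N = ((cocycle_rank X i).+1 + cobdry_rank X i)%N.
  by rewrite cardsC card_ord -ncellsE.
rewrite -(eqn_add2r #|~: T|) e [X in X == _]addnC.
by rewrite eqn_add2l eq_sym.
Qed.

End AcyclicRanks.

Lemma Zcyc_basis X i : homology_rank X i = 0%N ->
  exists (P : 'M[int]_(crank X i, cobdry_rank X i))
         (Q : 'M[int]_(cobdry_rank X i, crank X i)),
    [/\ is_basis (@Zcyc X i) P, Q *m P = 1%:M & P *m (Q *m bdry X i) = bdry X i].
Proof.
move=> hHpred.
have /kernel_basis[P [Q [BP QP PQ]]] :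
    (cobdry_rank X i + \rank (rat_mx (bdry_out X i)))%N = crank X i.
  by rewrite -free_rank_Zcyc // (free_rank_kernel (@ZcycP X i)).
exists P, Q; split=> //.
  split=> [x|y /(congr1 (mulmx Q))]; last by rewrite mulmxA QP mul1mx mulmx0.
  rewrite ZcycP; split=> [/PQ <-|[y ->]]; first by exists (Q *m x).
  by rewrite mulmxA BP mul0mx.
apply/trmx_inj/row_matrixP => j; rewrite -!tr_col; congr trmx.
by rewrite !colE -!mulmxA PQ // mulmxA bdry_out_bdry mul0mx.
Qed.

(** The minors of two systems of generators of the same lattice divide each
    other. *)
Lemma abs_minors_integral n r (S : 'M[int]_(r, n)) (D F : 'M[int]_(n, r))
    (G G' : 'M[int]_r) :
  D = F *m G -> F = D *m G' -> `|\det (S *m D)|%N = `|\det (S *m F)|%N.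
Proof.
move=> eD eF.
have SD : \det (S *m D) = \det (S *m F) * \det G by rewrite eD mulmxA det_mulmx.
have SF : \det (S *m F) = \det (S *m D) * \det G' by rewrite {1}eF mulmxA det_mulmx.
apply/eqP; rewrite eqn_dvd; apply/andP; split.
  by rewrite SF abszM dvdn_mulr.
by rewrite SD abszM dvdn_mulr.
Qed.

Lemma minors_rational n r (S : 'M[int]_(r, n)) (D F : 'M[int]_(n, r)) :
  ((rat_mx D)^T == (rat_mx F)^T)%MS ->
  (\det (S *m D) == 0) = (\det (S *m F) == 0).
Proof.
have half (A B : 'M[int]_(n, r)) : ((rat_mx A)^T <= (rat_mx B)^T)%MS ->
    \det (S *m B) == 0 -> \det (S *m A) == 0.
  case/submxP => G /(congr1 trmx); rewrite trmx_mul !trmxK => eA /eqP SB.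
  rewrite -(intr_eq0 rat) -rat_mx_det rat_mxM eA mulmxA -rat_mxM.
  by rewrite det_mulmx rat_mx_det SB mul0r.
by case/andP=> DF FD; apply/idP/idP; apply: half.
Qed.

Theorem theorem7p2p1 (X : cell_complex) (i : nat) (hi : (i <= cdim X)%N)
    (hHsucc : homology_rank X i.+2 = 0%N)
    (hH : homology_rank X i.+1 = 1%N)
    (hHpred : homology_rank X i = 0%N) :
  [/\ {in dual_cycletrees X i &,
         injective (fun U : {set 'I_(ncells X i)} => ~: U)},
      [set ~: U | U : {set 'I_(ncells X i)} in dual_cycletrees X i]%SET
        = spanning_trees X i
    & forall (T U : {set 'I_(ncells X i)})
        (Z : 'M[int]_(crank X i.+2, cocycle_rank X i))
        (Z' : 'M[int]_(crank X i.+1, (cobdry_rank X i).+1))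
        (db : 'M[int]_(crank X i.+1, cobdry_rank X i)),
      T \in spanning_trees X i -> U \in dual_cycletrees X i -> U = ~: T ->
      is_basis (@Zcoc X i.+2) Z -> is_basis (@Zcoc X i.+1) Z' ->
      reduced_cobdry db ->
      [/\ `|cutting_number Z' db (cocycle_part Z U)|%N
            = (wt_dual U
               * `|cutting_number Z' db (primitive_part (cocycle_part Z U))|)%N,
          integral_cobdry db ->
          (wt_dual U
             * `|cutting_number Z' db (primitive_part (cocycle_part Z U))|)%N
            = (wt_tree T * cohomology_order X i.+2)%N
        & cutting_number Z' db (cocycle_part Z U) = 0 <-> wt_tree T = 0%N]].
Proof.
have r_free := free_rank_Zcyc hHpred.
have m_rank := cocycle_rankE hHsucc.
have n_cells := ncellsE hHsucc hH.
have tree_compl := spanning_treeE hHsucc hH hHpred.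
split.
- by move=> U U' _ _ /(congr1 (fun A => ~: A)%SET); rewrite !finset.setCK.
- apply/setP=> T; apply/imsetP/idP => [[U UU ->]|TT].
    by rewrite tree_compl finset.setCK.
  by exists (~: T); rewrite ?finset.setCK // -tree_compl.
move=> T U Z Z' db TT UU UT bZ bZ' red_db.
have cardU : #|U| = (cocycle_rank X i).+1 by apply/eqP; move: UU; rewrite inE.
have cardT : #|T| = cobdry_rank X i by rewrite -r_free; apply/eqP; move: TT; rewrite inE.
have TU : T = ~: U by rewrite UT finset.setCK.
set m := cocycle_rank X i in Z bZ cardU n_cells m_rank *.
set r := cobdry_rank X i in Z' bZ' db red_db cardT n_cells *.
set JU := sel cardU; set JT := sel cardT.
have JJ : col_mx JU JT *m (col_mx JU JT)^T = 1%:M by apply: sel_orthonormal.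
pose E : 'M[int]_(m, ncells X i) := coords Z (cobdry X i.+1).
have ZE : Z *m E = cobdry X i.+1.
  apply: (coordsK bZ) => j; apply/ZcocP.
  by rewrite colE mulmxA cobdry_cobdry mul0mx.
have n_split : ncells X i = (m + (1 + r))%N by rewrite n_cells add1n addnS.
have [K [W [W' [V [V' [EKW WV WV' uWV]]]]]] := smith_completion E n_split.
have coh : cohomology_order X i.+2 = `|\det K|%N.
  apply: (quot_order_factor bZ EKW WV) => x; rewrite ZE; exact: BcobP.
have K0 : \det K != 0.
  by apply: (@det_neq0_of_rank _ _ _ Z K W); rewrite -mulmxA -EKW ZE -m_rank.
have kerE (x : 'cV_(ncells X i)) : E *m x = 0 -> Zcoc (k := i.+1) x.
  by move=> Ex; apply/ZcocP; rewrite -ZE -mulmxA Ex mulmx0.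
have EZ' : E *m Z' = 0.
  apply: (is_basis_inj bZ); rewrite mulmx0 mulmxA ZE.
  apply/matrixP=> a b; have /ZcocP/colP/(_ a) : Zcoc (k := i.+1) (col b Z').
    by apply/bZ'.1; exists (delta_mx b ord0); rewrite -colE.
  by rewrite colE mulmxA -colE !mxE.
have EV' : E *m V' = 0 by rewrite EKW -mulmxA WV' mulmx0.
have uVZ' : absdet (row_mx V (Z' : 'M_(_, 1 + r))) = 1%N.
  apply: (unimodular_completion n_split uWV).
  exists (coords Z' V'); rewrite (coordsK bZ') // => j; apply: kerE.
  by rewrite colE mulmxA EV' mul0mx.
set C := cocycle_part Z U.
have eC : C = JU^T *m signed_minors (E *m JU^T) by apply: cocycle_partE.
have EC : E *m C = 0 by rewrite eC mulmxA signed_minors_kernel.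
have ZC : Zcoc (k := i.+1) C by apply: kerE.
have Z'K p (M : 'M[int]_(ncells X i, p)) : E *m M = 0 -> Z' *m coords Z' M = M.
  move=> EM; apply: (coordsK bZ') => j; apply: kerE.
  by rewrite colE mulmxA EM mul0mx.
have Edb : E *m db = 0.
  apply: (is_basis_inj bZ); rewrite mulmx0 mulmxA ZE.
  apply: rat_mx_inj; apply: trmx_inj; rewrite rat_mxM trmx_mul rat_mx0 trmx0.
  have /andP[/submxP[G ->] _] := red_db.
  by rewrite -mulmxA -trmx_mul -rat_mxM cobdry_cobdry rat_mx0 trmx0 mulmx0.
have cutC : `|cutting_number Z' db C|%N = (`|\det K| * `|\det (JT *m db)|)%N.
  rewrite /cutting_number.
  rewrite (@det_signed_minors _ m r JU JT E K V Z' (coords Z' C) (coords Z' db)) //.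
  - by rewrite Z'K.
  - by rewrite EKW -mulmxA WV mulmx1.
  - exact: bZ'.2.
  - by rewrite Z'K.
have [KA [WA [WA' [VA [VA' [eA WVA _ uA]]]]]] :=
  @smith_completion m 1 _ (E *m JU^T) (esym (addn1 m)).
have wtU : wt_dual U = `|\det KA|%N by apply: (wt_dual_det cardT bZ ZE UT eA WVA).
have gcdC : gcd_entries C = `|\det KA|%N.
  rewrite eC; apply: (gcd_signed_minors eA (W' := WA') (J' := JU)).
    by have [] := absdet_inv (addn1 m) uA.
  have := JJ; rewrite tr_col_mx mul_col_row (@scalar_mx_block _ (1 + m) r).
  by case/eq_block_mx=> ->.
have cut_prim : `|cutting_number Z' db C|%N =
    (wt_dual U * `|cutting_number Z' db (primitive_part C)|)%N.
  rewrite wtU -gcdC; have eCp := primitive_partK C.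
  (* The primitive part of C is a cocycle only by division by the gcd, so the
     case of gcd 0 is apart: there C = 0. *)
  have [g0|g0] := eqVneq (gcd_entries C) 0%N.
    rewrite g0 mul0n; apply/eqP; rewrite absz_eq0 -eCp g0 scale0r.
    by rewrite -(scale0r C) cutting_numberZ // mul0r.
  rewrite -{1}eCp cutting_numberZ // ?abszM //; apply: kerE.
  apply/colP=> a; have /colP/(_ a) := EC; rewrite -{1}eCp -scalemxAr mxE [RHS]mxE.
  by move/eqP; rewrite mulf_eq0 eqz_nat (negbTE g0) => /eqP ->; rewrite mxE.
have [P [Q [bP QP PF]]] := Zcyc_basis hHpred.
set F := Q *m bdry X i in PF.
have wtT : wt_tree T = `|\det (JT *m F^T)|%N.
  by rewrite (wt_tree_det cardT cardU bP PF TU) -[in RHS]det_tr trmx_mul trmxK.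
have FD : F^T = cobdry X i *m Q^T by rewrite /F trmx_mul.
have DF : cobdry X i = F^T *m P^T by rewrite /cobdry -PF trmx_mul.
split=> //.
- move=> int_db; rewrite -cut_prim cutC coh mulnC; congr (_ * _)%N.
  have [B eB] : exists B, cobdry X i *m B = db.
    apply: lift_columns => j; apply/BcobP/int_db.
    by exists (delta_mx j ord0); rewrite -colE.
  have [G' eG'] : exists G', db *m G' = F^T.
    apply: lift_columns => j; apply/int_db/BcobP.
    by exists (Q^T *m delta_mx j ord0); rewrite mulmxA -FD -colE.
  rewrite wtT; apply: (@abs_minors_integral _ _ JT db F^T (P^T *m B) G') => //.
  by rewrite mulmxA -DF.
- have cut_wt : (cutting_number Z' db C == 0) = (wt_tree T == 0%N).
    rewrite -absz_eq0 cutC muln_eq0 !absz_eq0 (negbTE K0) wtT absz_eq0.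
    apply: minors_rational; apply/eqmxP.
    apply: eqmx_trans (eqmxP red_db) _; apply/eqmxP.
    apply/andP; split; last by rewrite FD rat_mxM trmx_mul submxMl.
    by rewrite DF rat_mxM trmx_mul submxMl.
  by split=> /eqP; [rewrite cut_wt | rewrite -cut_wt] => /eqP.
Qed.
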